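(* There exists a homogeneous Tychonoff space $X$ of weight $\mathfrak{c}$ with the following property: if $Y$ is a Tychonoff space, $f\colon X\to Y$ is a continuous surjection, and $\omega < w(Y) < \mathfrak{c}$, then $Y$ is not homogeneous.
   Context: $w(\cdot)$ denotes weight and $\mathfrak{c}=2^{\aleph_0}$. A space $Y$ is homogeneous if for any $y,z\in Y$ there is a homeomorphism of $Y$ onto itself mapping $y$ to $z$. *)

(* Defs.v *)
From HB Require Import structures.
From mathcomp Require Import all_boot all_order all_algebra.
From mathcomp Require Import all_classical all_reals all_analysis.
Set Implicit Arguments. Unset Strict Implicit. Unset Printing Implicit Defensive.
Local Open Scope classical_set_scope.

Definition tychonoff_space (T : topologicalType) : Prop :=
  accessible_space T /\ completely_regular_space T.

Definition is_base (T : topologicalType) (B : set (set T)) : Prop :=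
  (forall b, B b -> open b) /\
  (forall (U : set T) (x : T), open U -> U x ->
     exists b, [/\ B b, b x & b `<=` U]).

Definition weight_le (T : topologicalType) (U : Type) (K : set U) : Prop :=
  exists B : set (set T), is_base B /\ (B #<= K)%card.

Definition weight_lt (T : topologicalType) (U : Type) (K : set U) : Prop :=
  exists B : set (set T), [/\ is_base B, (B #<= K)%card & ~ (K #<= B)%card].

Definition continuum : set (nat -> bool) := [set: nat -> bool].

Definition homeomorphism (T : topologicalType) (f g : T -> T) : Prop :=
  [/\ cancel f g, cancel g f, continuous f & continuous g].

Definition homogeneous (T : topologicalType) : Prop :=
  forall y z : T, exists f g : T -> T, homeomorphism f g /\ f y = z.

(* Main.v *)
(** Take an almost disjoint family [a] of infinite subsets of a countable set and
    glue the point [i] to the cylinders [{n} x 2^omega], [n] in [a i], as their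
    one-point compactification.  The resulting space is locally a Cantor set, hence
    homogeneous, and its weight is [c] when the family has size [c].  Following
    Mrowka, the family can be chosen maximal and such that whenever two open sets
    have disjoint closures (with a little room), one of them lies in a finite union
    of compact open pieces.  To get this, start from the branches of the binary tree,
    extend them to a maximal family, and merge members in pairs: every subset of
    the tree almost containing uncountably many branches almost contains [c] many
    (perfect set theorem), so a recursion of length [c] merges, for every two such
    subsets, a branch of one with a branch of the other, and every other member
    with a branch.

    For a continuous surjection [f] onto [Y] it follows that at most one point of
    [Y] has no neighbourhood with bounded preimage; the other points have second
    countable neighbourhoods, being interior to images of Cantor sets.  If the
    weight of [Y] is below [c] the exceptional point [y0] does exist.  If [Y] is
    homogeneous, [y0] also has a second countable neighbourhood, outside of which
    preimages are bounded, so that [Y] is second countable. *)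

Require Import Defs.
From HB Require Import structures.
From mathcomp Require Import all_boot all_order all_algebra.
From mathcomp Require Import all_classical all_reals all_analysis.
From mathcomp Require wochoice.
From Stdlib Require Inverse_Image.
Set Implicit Arguments. Unset Strict Implicit. Unset Printing Implicit Defensive.

Local Open Scope classical_set_scope.

(** * Perfect sets and systems of distinct representatives *)

Notation cantor := (nat -> bool).
Notation node := (seq bool).

Definition has_continuum (T : Type) (F : set T) : Prop :=
  exists2 j : cantor -> T, injective j & forall u, F (j u).

Lemma has_continuumS (T : Type) (F G : set T) :
  F `<=` G -> has_continuum F -> has_continuum G.
Proof. by move=> FG [j ji jF]; exists j => // u; exact: FG. Qed.


Lemma card_le_inj_image (T U : Type) (f : T -> U) (A : set T) :
  injective f -> (A #<= f @` A)%card.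
Proof.
move=> fi; have /card_eqPle[] // : (f @` A #= A)%card.
by apply: inj_card_eq => x y _ _ /fi.
Qed.

Lemma inj_le (T U : Type) (F : set U) (j : T -> U) :
  injective j -> (forall u, F (j u)) -> ([set: T] #<= F)%card.
Proof.
move=> ji jF; apply: (@card_le_trans _ _ _ (range j)).
  exact: card_le_inj_image.
by apply: subset_card_le => _ [u _ <-].
Qed.

Lemma has_continuum_le (T : Type) (F : set T) :
  has_continuum F -> ([set: cantor] #<= F)%card.
Proof. by move=> [j ji jF]; exact: inj_le ji jF. Qed.

Lemma infinite_range (T : Type) (j : nat -> T) :
  injective j -> infinite_set (range j).
Proof. by move=> ji; apply/infiniteP; apply: (inj_le ji) => u; exists u. Qed.

Lemma first_difference (u v : cantor) : u <> v ->
  exists k, u k <> v k /\ forall j, (j < k)%N -> u j = v j.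
Proof.
move=> uv; have ex : exists k, u k != v k.
  by apply: contrapT => H; apply: uv; apply/funext => k; apply: contrapT => /eqP ne;
     apply: H; exists k.
case: (ex_minnP ex) => k /eqP uk kmin; exists k; split=> // j jk.
by apply: contrapT => /eqP /kmin; rewrite leqNgt jk.
Qed.

Definition pre (u : cantor) (n : nat) : node := mkseq u n.

Lemma size_pre u n : size (pre u n) = n. Proof. exact: size_mkseq. Qed.

Lemma preP u v n : pre u n = pre v n <-> forall k, (k < n)%N -> u k = v k.
Proof.
split=> [e k kn|e].
  by move/(congr1 (fun s => nth false s k)): e; rewrite !nth_mkseq.
by apply/eq_in_map => k; rewrite mem_iota add0n => /e.
Qed.

Lemma pre_leq u v m n : (m <= n)%N -> pre u n = pre v n -> pre u m = pre v m.
Proof. by move=> mn /preP e; apply/preP => k km; apply: e; exact: leq_trans mn. Qed.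

Lemma preS u n : pre u n.+1 = rcons (pre u n) (u n).
Proof. exact: mkseqS. Qed.

Definition cone (s : node) : set cantor := [set u | pre u (size s) = s].

Lemma cone_pre u n : cone (pre u n) u. Proof. by rewrite /cone/= size_pre. Qed.

Lemma cone_preP u v n : cone (pre u n) v <-> pre v n = pre u n.
Proof. by rewrite /cone/= size_pre. Qed.

Definition branch (b : cantor) : set node := range (pre b).

Lemma pre_inj b : injective (pre b).
Proof. by move=> m n /(congr1 size); rewrite !size_pre. Qed.

Lemma infinite_branch b : infinite_set (branch b).
Proof. exact/infinite_range/pre_inj. Qed.

Lemma branch_almost_disjoint b c : b <> c -> finite_set (branch b `&` branch c).
Proof.
move=> /first_difference[k [ne _]].
apply: (@sub_finite_set _ _ (pre b @` `I_k.+1)); last exact/finite_image/finite_II.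
move=> s [[n _ <-] [m _ e]]; exists n => //=.
have mn : m = n by move/(congr1 size): e; rewrite !size_pre.
rewrite mn in e; rewrite ltnS leqNgt; apply/negP => kn.
by apply: ne; move/preP: e => /(_ k kn).
Qed.

Section PerfectSet.
Variables (F : set cantor).
Hypothesis F_closed :
  forall u, (forall n, exists2 v, F v & pre v n = pre u n) -> F u.

Let fat s := ~ countable (F `&` cone s).

(** If nothing splits above [s], two points of [T0] would first differ right after a splitting node,
    so [T0] has at most one point; the rest of [F] in the cone lies in countably many cones with
    countable trace. *)
Lemma fat_split s : fat s -> exists t,
  fat (rcons (s ++ t) false) /\ fat (rcons (s ++ t) true).
Proof.
move=> fs; apply: contrapT => noS; apply: fs.
pose T0 := [set u | cone s u /\ forall n, (size s <= n)%N -> fat (pre u n)].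
have T0c : countable T0.
  have [[x xT]|] := pselect (T0 !=set0); last first.
    by move=> /set0P/negP; rewrite negbK => /eqP ->; exact: countable0.
  apply: (sub_countable _ (countable1 x)); apply: subset_card_le => y yT /=.
  apply: contrapT => /first_difference[k [ne e]].
  have sk : (size s <= k)%N.
    rewrite leqNgt; apply/negP => ks; apply: ne.
    by have /preP := etrans (proj1 yT) (esym (proj1 xT)); apply.
  have epre : pre x k = pre y k by apply/preP => j /e/esym.
  have [t et] : exists t, pre x k = s ++ t.
    exists (drop (size s) (pre x k)); rewrite -{1}(cat_take_drop (size s) (pre x k)).
    congr (_ ++ _); rewrite -[RHS](proj1 xT : pre _ _ = _).
    by rewrite /pre /mkseq -map_take take_iota (minn_idPl sk).
  apply: noS; exists t; rewrite -et.
  have := proj2 xT k.+1 (leqW sk); have := proj2 yT k.+1 (leqW sk).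
  rewrite !preS -epre; case: (x k) (y k) ne => -[] //.
apply: (@sub_countable _ _ _
  (T0 `|` \bigcup_(t in [set t | ~ fat t]) (F `&` cone t))).
  apply: subset_card_le => u [Fu su].
  have [h|h] := pselect (forall n, (size s <= n)%N -> fat (pre u n)).
    by left.
  right; have [n nf] : exists n, ~ fat (pre u n).
    by apply: contrapT => H; apply: h => n _; apply: contrapT => nf; apply: H; exists n.
  by exists (pre u n) => //; split=> //; exact: cone_pre.
rewrite -bigcup2E; apply: bigcup_countable => // -[|[|i]] _ //=.
by apply: bigcup_countable => // t /contrapT.
Qed.

(** Cantor scheme: [G u n] is the fat node reached after [n] splittings steered by [u], and the
    limit [L u] is in [F] by closedness. *)
Lemma perfect_set : ~ countable F -> has_continuum F.
Proof.
move=> nF.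
have /choice[sp spP] : forall s, exists t, fat s ->
    fat (rcons (s ++ t) false) /\ fat (rcons (s ++ t) true).
  move=> s.
  have [/fat_split[t ?]|] := pselect (fat s); first by exists t.
  by exists [::].
pose G (u : cantor) := fix G n :=
  if n is m.+1 then rcons (G m ++ sp (G m)) (u m) else [::].
have Gfat u n : fat (G u n).
  elim: n => [|n IH] /=.
    rewrite /fat; move: nF; apply: contra_not; apply: sub_countable.
    by apply: subset_card_le => v Fv.
  by have [] := spP _ IH; case: (u n).
have Gpre u n m : (n <= m)%N -> exists t, G u m = G u n ++ t.
  move=> /subnK <-; elim: (m - n)%N => [|d [t IH]]; first by exists [::]; rewrite cats0.
  rewrite addSn /= IH; eexists; rewrite -cats1 -!catA; reflexivity.
have Gsize u n : (n <= size (G u n))%N.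
  elim: n => //= n IH; rewrite size_rcons size_cat ltnS.
  exact: leq_trans IH (leq_addr _ _).
have Gnth u n m k : (n <= m)%N -> (k < size (G u n))%N ->
    nth false (G u m) k = nth false (G u n) k.
  by move=> /(Gpre u)[t ->] kn; rewrite nth_cat kn.
(* [G u k.+1] has more than [k] letters, so its letter [k] exists and is final. *)
pose L u : cantor := fun k => nth false (G u k.+1) k.
have LG u n : pre (L u) (size (G u n)) = G u n.
  apply: (@eq_from_nth _ false); rewrite size_pre // => k kn.
  rewrite nth_mkseq // /L.
  have [le|/ltnW le] := leqP k.+1 n; last exact: Gnth.
  by rewrite -(Gnth u k.+1 n k le) //; exact: Gsize.
exists L.
  move=> u v LL; apply: contrapT => /first_difference[k [ne e]].
  have eG : G u k = G v k.
    by elim: k e {ne} => //= k IH e; rewrite IH ?e // => j jk; apply: e; exact: ltnW.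
  have := LG u k.+1; have := LG v k.+1; rewrite LL /= eG !size_rcons => -> /rcons_inj[].
  by move/esym.
move=> u; apply: F_closed => n.
have [v [Fv cv]] : (F `&` cone (G u n)) !=set0.
  apply: contrapT => /set0P/negP; rewrite negbK => /eqP e0.
  by apply: (Gfat u n); rewrite e0; exact: countable0.
exists v => //; apply: (pre_leq (Gsize u n)); rewrite LG; exact: cv.
Qed.

End PerfectSet.

(** [F] is the union of the closed sets [E m] of branches staying in [S] from level [m] on; one of
    them is uncountable. *)
Lemma branches_almost_inside (S : set node) :
  let F := [set b | finite_set (branch b `\` S)] in
  ~ countable F -> has_continuum F.
Proof.
move=> F nF; pose E m := [set b | forall k, (m <= k)%N -> S (pre b k)].
have EF m : E m `<=` F.
  move=> b Eb; apply: (@sub_finite_set _ _ (pre b @` `I_m));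
    last exact/finite_image/finite_II.
  move=> _ [[k _ <-] nS]; exists k => //=; rewrite ltnNge; apply/negP => mk.
  by apply: nS; exact: Eb.
have FE : F `<=` \bigcup_m E m.
  move=> b fb; apply: contrapT => H; move: fb.
  have nx m : exists k, (m <= k)%N /\ ~ S (pre b k).
    apply: contrapT => h; apply: H; exists m => // k mk; apply: contrapT => nS.
    by apply: h; exists k.
  move=> fin.
  have : finite_set [set k | ~ S (pre b k)].
    have : finite_set (pre b @` [set k | ~ S (pre b k)]).
      by apply: sub_finite_set fin => _ [k nS <-]; split=> //; exists k.
    apply: contraPP => inf; move/infiniteP: inf => inf.
    apply/infiniteP; apply: (card_le_trans inf).
    exact/card_le_inj_image/pre_inj.
  move=> /finite_seqP[s es].
  have [k [mk nS]] := nx (\max_(i <- s) i).+1.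
  have : [set` s] k by rewrite -es.
  by move=> /= ks; move: mk; rewrite ltnNge (leq_bigmax_seq (F:=id)).
have [m nm] : exists m, ~ countable (E m).
  apply: contrapT => H; apply: nF; apply: (@sub_countable _ _ _ (\bigcup_m E m)).
    exact: subset_card_le.
  apply: bigcup_countable => // m _; apply: contrapT => nm; apply: H; by exists m.
apply: (has_continuumS (EF m)); apply: perfect_set nm => u H k mk.
by have [v Ev <-] := H k; exact: Ev.
Qed.

(* A well-order of type [c]: all proper initial segments are smaller than the continuum. *)
Lemma continuum_order : exists lt : cantor -> cantor -> Prop,
  [/\ well_founded lt, (forall x y, x <> y -> lt x y \/ lt y x) &
      forall x, ~ has_continuum [set y | lt y x]].
Proof.
have [R wR] := wochoice.well_ordering_principle (cantor : eqType).
pose lt x y := R x y /\ x <> y.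
have minR (A : set cantor) : A !=set0 -> exists2 z, A z & forall x, A x -> R z x.
  move=> [a Aa]; have [|z [[Az lbz] _]] := wR [pred x | x \in A].
    by exists a; rewrite !inE.
  exists z => [|x Ax]; first by move: Az; rewrite !inE.
  by apply: lbz; rewrite !inE.
have anti x y : R x y -> R y x -> x = y.
  move=> xy yx.
  have refl t : R t t.
    by have [|w -> /(_ t erefl)] := minR [set t]; first by exists t.
  have [|z [_ uz]] := wR [pred t | t \in [set x; y]].
    by exists x; rewrite !inE; left.
  have zx : z = x.
    by apply: uz; split=> [|t]; rewrite !inE; [left|move=> [] ->].
  have zy : z = y.
    by apply: uz; split=> [|t]; rewrite !inE; [right|move=> [] ->].
  by rewrite -zx -zy.
have tot x y : R x y \/ R y x.
  have [|z zxy lbz] := minR [set x; y]; first by exists x; left.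
  by case: zxy lbz => -> lbz; [left; apply: lbz; right|right; apply: lbz; left].
have wf : well_founded lt.
  move=> x; apply: contrapT => nx.
  have [|z nz zmin] := minR [set x | ~ Acc lt x]; first by exists x.
  apply: nz; constructor => y [yz ne]; apply: contrapT => ny.
  by apply: ne; apply: anti => //; exact: zmin.
have ltot x y : x <> y -> lt x y \/ lt y x.
  by move=> ne; have [?|?] := tot x y; [left|right]; split=> //; exact/nesym.
have [H|H] := pselect (exists x, has_continuum [set y | lt y x]); last first.
  by exists lt; split=> // x hx; apply: H; exists x.
(* For the least [x] with a large initial segment, the order pulled back along [j] has only small
   segments. *)
have [|x [j ji jx] xmin] := minR [set x | has_continuum [set y | lt y x]].
  by case: H => x hx; exists x.
exists (fun u v => lt (j u) (j v)); split.
- exact: (Inverse_Image.wf_inverse_image _ _ _ j wf).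
- by move=> u v ne; apply: ltot => /ji.
- move=> v [k ki kv].
  have [vx ne] := jx v; apply: ne; apply: anti => //.
  by apply: xmin; exists (j \o k) => [|u]; [exact: inj_comp|exact: kv].
Qed.

(** Recursion along the order pulled back by [e]: fewer than continuum many values are taken before
    stage [i], so [G i] still has a free one. *)
Lemma distinct_representatives (I : Type) (e : I -> cantor) (G : I -> set cantor) :
  injective e -> (forall i, has_continuum (G i)) ->
  exists2 r : I -> cantor, injective r & forall i, G i (r i).
Proof.
move=> ei hG; have [lt [wf tot small]] := continuum_order.
pose ltI i j := lt (e i) (e j).
have wfI : well_founded ltI by exact: Inverse_Image.wf_inverse_image.
have step (i : I) (h : forall j, ltI j i -> cantor) :
    exists u, G i u /\ forall j (p : ltI j i), h j p <> u.
  apply: contrapT => H; apply: (small (e i)).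
  have [g gi gG] := hG i.
  (* If [G i] is exhausted, each [g u] is an earlier value; the codes [e j] of the stages [j] used
     give continuum many elements below [e i]. *)
  have /choice[k kP] : forall u, exists v j (p : ltI j i), e j = v /\ h j p = g u.
    move=> u; apply: contrapT => nj; apply: H; exists (g u); split=> // j p hj.
    by apply: nj; exists (e j), j, p.
  exists k => [u v kuv|u]; last by have [j [p [<- _]]] := kP u.
  have [j [p [ej hj]]] := kP u; have [j' [p' [ej' hj']]] := kP v.
  have jj : j = j' by apply: ei; rewrite ej ej' kuv.
  subst j'; apply: gi; rewrite -hj -hj'; congr h; exact: Prop_irrelevance.
pose F i h := projT1 (cid (step i h)).
pose r := Fix wfI (fun=> cantor) F.
have rE i : r i = F i (fun j _ => r j).
  rewrite /r Fix_eq // => x f g fg; congr F.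
  by apply: functional_extensionality_dep => j; apply/funext => p; exact: fg.
have rlt i j : ltI j i -> r j <> r i.
  by move=> p; rewrite (rE i); have [_] := projT2 (cid (step i (fun j _ => r j)));
     exact.
exists r => [i j rij|i]; last first.
  by rewrite rE; have [] := projT2 (cid (step i (fun j _ => r j))).
apply: ei; apply: contrapT => /tot[] /rlt; first by move=> /(_ rij).
by move=> /(_ (esym rij)).
Qed.

(** * A maximal almost disjoint family in which large traces meet *)

Lemma set_code (T : countType) : exists e : set T -> cantor, injective e.
Proof.
exists (fun F k => if unpickle k is Some x then `[< F x >] else false) => F G FG.
apply/funext => x; apply/propext.
move/(congr1 (fun u : cantor => u (pickle x))): FG; rewrite pickleK => e.
by split=> /asboolP; [rewrite e|rewrite -e] => /asboolP.
Qed.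

(* [mf_merge] is the extra requirement, beyond a maximal almost disjoint family of size [c]: it
   forces two large open sets of the associated space to have a common limit point [inr i]. *)
Record mrowka_family (I : Type) (a : I -> set node) : Prop := MrowkaFamily {
  mf_continuum : has_continuum [set: I];
  mf_infinite : forall i, infinite_set (a i);
  mf_disjoint : forall i j, i <> j -> finite_set (a i `&` a j);
  mf_maximal : forall E, infinite_set E -> exists i, infinite_set (a i `&` E);
  mf_merge : forall S S' : set node,
    ~ countable [set i | finite_set (a i `\` S)] ->
    ~ countable [set i | finite_set (a i `\` S')] ->
    exists i, infinite_set (a i `&` S) /\ infinite_set (a i `&` S') }.

(** Zorn's lemma on the sets added to the branches: the branches and [B] together are maximal almost
    disjoint. *)
Lemma maximal_almost_disjoint_branches : exists B : set (set node),
  [/\ (forall A, B A -> infinite_set A),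
      (forall A b, B A -> finite_set (A `&` branch b)),
      (forall A A', B A -> B A' -> A <> A' -> finite_set (A `&` A')) &
      forall E, infinite_set E -> (forall b, finite_set (E `&` branch b)) ->
        exists2 A, B A & infinite_set (A `&` E)].
Proof.
pose P (B : set (set node)) := [/\ (forall A, B A -> infinite_set A),
  (forall A b, B A -> finite_set (A `&` branch b)) &
  (forall A A', B A -> B A' -> A <> A' -> finite_set (A `&` A'))].
have [|B [[B1 B2 B3] Bmax]] := @Zorn_bigcup _ P.
  move=> F FP tot; split.
  - by move=> A [B FB BA]; have [+ _ _] := FP _ FB; exact.
  - by move=> A b [B FB BA]; have [_ + _] := FP _ FB; exact.
  - move=> A A' [B FB BA] [B' FB' BA'].
    have [BB|BB] := tot _ _ FB FB'.
      by have [_ _] := FP _ FB'; apply => //; exact: BB.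
    by have [_ _] := FP _ FB; apply => //; exact: BB.
exists B; split=> // E iE Eb; apply: contrapT => H.
have fE A : B A -> finite_set (A `&` E).
  by move=> BA; apply: contrapT => nf; apply: H; exists A.
apply: (Bmax (B `|` [set E])).
  split; first exact: subsetUl.
  move=> sub; apply: iE; rewrite -[E]setIid; apply: fE; apply: sub; by right.
split.
- by move=> A [/B1|->].
- by move=> A b [/B2|->].
- move=> A A' [BA|->] [BA'|->] // ne; first exact: B3.
    exact: fE.
  by rewrite setIC; exact: fE.
Qed.

Lemma infinite_almost_inside (T : Type) (A S : set T) :
  infinite_set A -> finite_set (A `\` S) -> infinite_set (A `&` S).
Proof.
move=> iA fA fS; apply: iA; rewrite -(setDUK (@subIsetl _ A S)) finite_setU.
by split=> //; apply: sub_finite_set fA => x [Ax H]; split=> // Sx; apply: H.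
Qed.

(* A task [inl (S, S', b)] asks for a branch almost inside [S] or [S'] according to [b], the two
   branches being merged; [inr B] asks for a branch to be merged with the member [B]. *)
Definition task : Type := ((set node * set node * bool) + set node)%type.

Lemma task_code : exists e : task -> cantor, injective e.
Proof.
have [e ei] := set_code (nat * node)%type.
(* Layer [0] tells [inl] from [inr], layers [1] and [2] carry the sets, later layers the bit. *)
pose code (t : task) : set (nat * node) := fun p =>
  match t with
  | inl (U, V, b) => match p.1 with
                     0 => True | 1 => U p.2 | 2 => V p.2 | _ => b end
  | inr B => if p.1 is 1 then B p.2 else False
  end.
exists (e \o code); apply: inj_comp => // t t' tt'.
have E k s : code t (k, s) = code t' (k, s) by rewrite tt'.
case: t t' E {tt'} => [[[S S'] b]|B] [[[T T'] c]|D] E.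
- congr (inl (_, _, _)).
  + by apply/funext => s; exact: (E 1%N s).
  + by apply/funext => s; exact: (E 2%N s).
  + by have := E 3%N [::]; rewrite /= => bc; apply/idP/idP; rewrite bc.
- by have /= TF := E 0%N [::]; suff : False by []; rewrite -TF.
- by have /= FT := E 0%N [::]; suff : False by []; rewrite FT.
- by congr inr; apply/funext => s; exact: (E 1%N s).
Qed.

Lemma mrowka_family_exists : exists (I : Type) (a : I -> set node), mrowka_family a.
Proof.
have [B [B1 B2 B3 B4]] := maximal_almost_disjoint_branches.
pose F (S : set node) := [set b | finite_set (branch b `\` S)].
have [e ei] := task_code.
(* When there are not continuum many suitable branches the condition is vacuous, so [G t] has size
   continuum in every case. *)
pose G (t : task) : set cantor := fun u =>
  if t is inl (U, V, b) then
    has_continuum (F (if b then V else U)) -> F (if b then V else U) u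
  else True.
have [|r ri rG] := @distinct_representatives task e G ei.
  move=> [[[S S'] b]|D]; last by exists id.
  have [h|h] := pselect (has_continuum (F (if b then S' else S))).
    by apply: (has_continuumS _ h) => u Fu _.
  by exists id => // u /h.
pose key S S' := r (inl (S, S', false)).
pose lock S S' := r (inl (S, S', true)).
(* Members of the new family are indexed by the branches that are not absorbed by a [key]. *)
pose J c := ~ exists S S', c = lock S S'.
(* A key is merged with its lock, the branch of task [inr D] with [D]; all other branches get an
   empty partner. *)
pose partner c := [set s | (exists S S', c = key S S' /\ branch (lock S S') s) \/
                          (exists D, [/\ B D, c = r (inr D) & D s])].
have partnerP c : [\/ partner c = set0,
    (exists S S', c = key S S' /\ partner c = branch (lock S S')) |
    (exists D, [/\ B D, c = r (inr D) & partner c = D])].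
  have [[S [S' cE]]|nk] := pselect (exists S S', c = key S S').
    apply: Or32; exists S, S'; split=> //; apply/seteqP; split=> s.
      move=> [[T [T' [cT]]]|[D [_ + _]]]; last by rewrite cE => /ri.
      by move: cT; rewrite cE => /ri[-> ->].
    by move=> ls; left; exists S, S'.
  have [[D [BD cE]]|nB] := pselect (exists D, B D /\ c = r (inr D)).
    apply: Or33; exists D; split=> //; apply/seteqP; split=> s.
      move=> [[T [T' [cT]]]|[D' [_ + D's]]]; first by move: cT; rewrite cE => /ri.
      by rewrite cE => /ri[->].
    by move=> Ds; right; exists D.
  apply: Or31; apply/seteqP; split=> s // [[S [S' [cE _]]]|[D [BD cE _]]].
    by apply: nk; exists S, S'.
  by apply: nB; exists D.
have Jkey S S' : J (key S S') by move=> [T [T' /ri]].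
have JB D : J (r (inr D)) by move=> [T [T' /ri]].
pose I := {c | J c}; pose a (i : I) := branch (sval i) `|` partner (sval i).
exists I, a; split.
(* Distinct [u] give distinct level sets, hence distinct keys; [nseq n true] is merely a node of
   length [n]. *)
- have e0 : forall u : cantor, J (key [set s | u (size s)] set0) by move=> u; exact: Jkey.
  exists (fun u => exist J _ (e0 u)) => // u v /(congr1 (@sval _ _)) /= /ri[uv].
  apply/funext => n; apply/idP/idP.
    by move=> un; have : [set s : node | v (size s)] (nseq n true);
       [rewrite -uv /= size_nseq|rewrite /= size_nseq].
  by move=> vn; have : [set s : node | u (size s)] (nseq n true);
     [rewrite uv /= size_nseq|rewrite /= size_nseq].
- move=> i; apply: sub_infinite_set (infinite_branch (b := sval i)).
  exact: subsetUl.
- move=> [c Jc] [d Jd] ne.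
  have {}ne : c <> d by move=> cd; apply: ne; exact: eq_exist.
  (* A branch in [J] is not a lock, so it differs from every lock that occurs as a partner. *)
  have branch_partner b b' : J b -> b <> b' -> finite_set (branch b `&` partner b').
    move=> Jb nb; case: (partnerP b') => [->|[S [S' [b'E ->]]]|[D [BD _ ->]]].
    + by rewrite setI0.
    + apply: branch_almost_disjoint => bE; apply: Jb; by exists S, S'.
    + by rewrite setIC; exact: B2.
  have pp : finite_set (partner c `&` partner d).
    case: (partnerP c) => [->|[S [S' [cE ->]]]|[D [BD cE ->]]]; first by rewrite set0I.
      case: (partnerP d) => [->|[T [T' [dE ->]]]|[D [BD dE ->]]].
      + by rewrite setI0.
      + apply: branch_almost_disjoint => /ri[SE S'E].
        by apply: ne; rewrite cE dE SE S'E.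
      + by rewrite setIC; exact: B2.
    case: (partnerP d) => [->|[T [T' [dE ->]]]|[D' [BD' dE ->]]].
    + by rewrite setI0.
    + exact: B2.
    + by apply: B3 => // DD; apply: ne; rewrite cE dE DD.
  rewrite /a /= setIUl !(setIUr _ (branch d)) finite_setU; split; rewrite finite_setU; split=> //.
  + exact: branch_almost_disjoint.
  + by apply: branch_partner.
  + by rewrite setIC; apply: branch_partner => //; exact/nesym.
- move=> E iE.
  (* A branch meeting [E] infinitely is itself an index, or is a lock absorbed by its key; if there
     is none, [B4] gives some [D], absorbed by the branch of [inr D]. *)
  have [[b ib]|nb] := pselect (exists b, infinite_set (E `&` branch b)).
    have [Jb|/contrapT[S [S' bE]]] := pselect (J b).
      exists (exist J _ Jb); apply: sub_infinite_set ib => s [Es bs].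
      by split=> //; left.
    exists (exist J _ (Jkey S S')); apply: sub_infinite_set ib => s [Es bs].
    by split=> //; right; left; exists S, S'; rewrite -bE.
  have [b|D BD iD] := B4 _ iE.
    by apply: contrapT => ib; apply: nb; exists b.
  exists (exist J _ (JB D)); apply: sub_infinite_set iD => s [Ds Es].
  by split=> //; right; right; exists D.
(* Forgetting partners leaves uncountably many branches almost inside [S], hence continuum many. *)
- have Fc S : ~ countable [set i | finite_set (a i `\` S)] -> has_continuum (F S).
    move=> nc; apply: branches_almost_inside; apply: contra_not nc.
    apply: sub_countable.
    apply: (card_le_trans (@card_le_inj_image _ _ (@sval _ _) _ _)).
      by move=> [c Jc] [d Jd] /= cd; exact: eq_exist.
    apply: subset_card_le => _ [i fi <-]; apply: sub_finite_set fi => s [bs nS].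
    by split=> //; left.
  move=> S S' /Fc cS /Fc cS'.
  exists (exist J _ (Jkey S S')); split.
    have := infinite_almost_inside (infinite_branch (b := key S S'))
      (rG (inl (S, S', false)) cS).
    by apply: sub_infinite_set => s [bs Ss]; split=> //; left.
  have := infinite_almost_inside (infinite_branch (b := lock S S'))
    (rG (inl (S, S', true)) cS').
  by apply: sub_infinite_set => s [bs Ss]; split=> //; right; left; exists S, S'.
Qed.

(** * Topological preliminaries *)

(* The product topology of [nat -> bool], in terms of initial segments. *)
Definition cantor_open (W : set cantor) : Prop :=
  forall u, W u -> exists m, forall v, pre v m = pre u m -> W v.

Lemma cantor_openT : cantor_open setT. Proof. by move=> u _; exists 0%N. Qed.

Lemma cantor_openI W W' : cantor_open W -> cantor_open W' -> cantor_open (W `&` W').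
Proof.
move=> oW oW' u [/oW[m mW] /oW'[m' mW']]; exists (maxn m m') => v e; split.
  by apply: mW; apply: pre_leq e; exact: leq_maxl.
by apply: mW'; apply: pre_leq e; exact: leq_maxr.
Qed.

Lemma cantor_open_preimage (g : cantor -> cantor) W :
  (forall u m, exists p, forall v, pre v p = pre u p -> pre (g v) m = pre (g u) m) ->
  cantor_open W -> cantor_open (g @^-1` W).
Proof.
move=> cg oW u /oW[m mW]; have [p pP] := cg u m.
by exists p => v /pP; exact: mW.
Qed.

(** Compactness of $2^\omega$: if the root fails, every failing node has a failing child, and
    following these gives a sequence without good prefix. *)
Lemma cantor_fan (Q : node -> Prop) :
  (forall s, Q (rcons s false) -> Q (rcons s true) -> Q s) ->
  (forall u, exists m, Q (pre u m)) -> Q [::].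
Proof.
move=> Qsplit Qloc; apply: contrapT => nQ.
have /choice[d dP] : forall s, exists b, ~ Q s -> ~ Q (rcons s b).
  move=> s; have [Qf|] := pselect (Q (rcons s false)); last by exists false.
  by exists true => nQs Qt; apply: nQs; exact: Qsplit.
pose G := fix G n := if n is m.+1 then rcons (G m) (d (G m)) else [::].
have nG n : ~ Q (G n) by elim: n => //= n /dP.
have preG n : pre (fun k => d (G k)) n = G n by elim: n => //= n IH; rewrite preS IH.
have [m] := Qloc (fun k => d (G k)); rewrite preG; exact: nG.
Qed.

Lemma cone_rcons s u : cone s u -> cone (rcons s (u (size s))) u.
Proof. by rewrite /cone /= size_rcons preS => ->. Qed.

Section TopologicalPreliminaries.
Variable Y : topologicalType.

Definition countable_base_on (V : set Y) : Prop :=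
  exists2 b : nat -> set Y, (forall k, open (b k)) &
    forall y U, V y -> open U -> U y -> exists k, b k y /\ b k `<=` U.

Lemma open_local (A : set Y) :
  (forall x, A x -> exists W, [/\ open W, W x & W `<=` A]) -> open A.
Proof.
move=> H; rewrite openE => x /H[W [oW Wx WA]]; rewrite /interior /= nbhsE.
by exists W.
Qed.

Lemma hausdorff_separate (x y : Y) : hausdorff_space Y -> x <> y ->
  exists A B, [/\ open A, open B, A x, B y & forall z, A z -> ~ B z].
Proof.
rewrite open_hausdorff => H /eqP /H[[A B] /= [/set_mem Ax /set_mem By] [oA oB /eqP AB]].
exists A, B; split=> // z Az Bz; have : (A `&` B) z by [].
by rewrite AB.
Qed.

(** The base sets [b l] collect the points of [V] whose whole fibre lies in the finite union [cov l]
    of cones. They are open because images of compact sets are closed, and form a base because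
    fibres are compact; [cantor_fan] serves for both. *)
Lemma cantor_image_base (V : set Y) (psi : cantor -> Y) :
  hausdorff_space Y -> open V -> V `<=` range psi ->
  (forall U, open U -> cantor_open (psi @^-1` U)) -> countable_base_on V.
Proof.
move=> hY oV Vpsi cpsi.
pose cov (l : seq node) := [set u | exists2 s, s \in l & cone s u].
pose b (l : seq node) := V `\` psi @` (~` cov l).
have ob l : open (b l).
  apply: open_local => y [Vy ny].
  pose Q s := exists W, [/\ open W, W y &
    forall u, cone s u -> ~ cov l u -> ~ W (psi u)].
  have [s [W [oW Wy sW]] [W' [oW' W'y sW']]|u|W [oW Wy WP]] := @cantor_fan Q.
  - exists (W `&` W'); split; [exact: openI|by []|].
    move=> u /cone_rcons; case: (u _) => cu ncu [Wu W'u].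
      exact: sW' cu ncu W'u.
    exact: sW cu ncu Wu.
  - have [[s sl su]|ncu] := pselect (cov l u).
      exists (size s), setT; split=> //; first exact: openT.
      move=> v; rewrite su => sv nv _; apply: nv; by exists s.
    have [|A [B [oA oB Ay Bu AB]]] := @hausdorff_separate y (psi u) hY.
      by move=> yu; apply: ny; exists u.
    have [m mB] := cpsi B oB u Bu; exists m, A; split=> // v /cone_preP/mB Bv _ Av.
    exact: AB Av Bv.
  exists (V `&` W); split; [exact: openI|by []|].
  move=> z [Vz Wz]; split=> // -[u ncu uz]; apply: (WP u) => //.
  by rewrite uz.
exists (fun k => if unpickle k is Some l then b l else set0).
  by move=> k; case: (unpickle k) => [l|]; [exact: ob|exact: open0].
move=> y U Vy oU Uy.
pose Q s := exists l, (forall u, cov l u -> U (psi u)) /\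
  (forall u, cone s u -> psi u = y -> cov l u).
have [s [l [lU sl]] [l' [l'U sl']]|u|l [lU lP]] := @cantor_fan Q.
- exists (l ++ l'); split.
    by move=> u [t]; rewrite mem_cat => /orP[] tl tu; [apply: lU|apply: l'U]; exists t.
  move=> u /cone_rcons; case: (u _) => [/sl'|/sl] H /H [t tl tu]; exists t => //.
    by rewrite mem_cat tl orbT.
  by rewrite mem_cat tl.
- have [yu|nyu] := pselect (psi u = y).
    have [|m mU] := cpsi U oU u; first by rewrite /= yu.
    exists m, [:: pre u m]; split.
      by move=> v [_ /[1!inE] /eqP-> /cone_preP/mU].
    by move=> v cv _; exists (pre u m); rewrite ?inE.
  have [A [B [oA oB Au By AB]]] := hausdorff_separate hY nyu.
  have [m mA] := cpsi A oA u Au; exists m, [::]; split=> [v [] //|v].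
  by move=> /cone_preP/mA Av vy; case: (AB _ Av); rewrite vy.
exists (pickle l); rewrite pickleK; split.
  by split=> // -[u ncu uy]; apply: ncu; apply: lP uy.
move=> z [Vz nz]; have [u _ uz] := Vpsi z Vz.
rewrite -uz; apply: lU; apply: contrapT => ncu; apply: nz; by exists u.
Qed.

(** The separating uniformity has a coarser topology, hence larger closures, so its regularity also
    bounds the closure in [Y]. *)
Lemma completely_regular_shrink (y : Y) (U : set Y) :
  completely_regular_space Y -> open U -> U y ->
  exists V, [/\ open V, V y & closure V `<=` U].
Proof.
move=> crY oU Uy.
have [|//|uT [E [entE EU finer]]] := crY y (~` U); first exact: open_closedC.
pose UT := Uniform.Pack uT.
have [A Ay AE] := @uniform_regular UT y (xsection E y) (@nbhs_entourage UT y E entE).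
exists (interior (A : set Y)); split.
- exact: open_interior.
- exact: finer.
- move=> z clz; apply: contrapT => nUz.
  have : xsection E y z.
    apply: AE => B /finer /clz [w [Aw Bw]]; exists w; split=> //.
    exact: interior_subset Aw.
  move=> /xsectionP Eyz; have : ([set y] `*` ~` U `&` E) (y, z) by [].
  by rewrite EU.
Qed.

(** The uniformity is pulled back from discrete [bool]; having equal images is an entourage. *)
Lemma bool_separator (A B : set Y) (f : Y -> bool) :
  continuous f -> (forall z, A z -> f z) -> (forall z, B z -> ~~ f z) ->
  uniform_separator A B.
Proof.
move=> cf fA fB.
pose T' : uniformType := initial_topology f.
exists (Uniform.class T'), ([set xy | f xy.1 = f xy.2]); split.
- exists [set xy | xy.1 = xy.2] => //.
  by rewrite uniform_discrete => _ [z _ <-].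
- rewrite -subset0 => -[z w] [[/= /fA fz /fB fw]] fzw.
  by move: fw; rewrite -fzw fz.
- move=> z U [V [[W oW <- /=]]] ? /filterS; apply.
  by apply: cf; exact: open_nbhs_nbhs.
Qed.

Lemma clopen_separator (x : Y) (N B : set Y) :
  clopen N -> N x -> N `<=` ~` B -> uniform_separator [set x] B.
Proof.
move=> [oN cN] Nx NB; apply: (@bool_separator _ _ (fun z => `[< N z >])).
- apply/continuousP => A _.
  have -> : (fun z => `[< N z >]) @^-1` A =
      (if pselect (A true) then N else set0) `|`
      (if pselect (A false) then ~` N else set0).
    apply/seteqP; split=> z /=.
      by case: asboolP => Nz Az; [left|right]; case: pselect.
    move=> [|]; case: pselect => // Az Nz.
      by rewrite (asboolT Nz).
    by rewrite (asboolF Nz).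
  by apply: openU; case: pselect => ? //; [exact: open0|exact: closed_openC|exact: open0].
- by move=> z ->; exact/asboolP.
- by move=> z Bz; apply/asboolP => /NB.
Qed.

End TopologicalPreliminaries.

(** * The space of an almost disjoint family *)

(* [inl (n, t)] is the point [t] of the [n]-th Cantor set, [inr i] the point glued to [a i]. *)
Definition psi_space (I : choiceType) (a : I -> set node) : Type :=
  (node * cantor + I)%type.

HB.instance Definition _ (I : choiceType) (a : I -> set node) :=
  gen_eqMixin (psi_space a).
HB.instance Definition _ (I : choiceType) (a : I -> set node) :=
  gen_choiceMixin (psi_space a).

Section PsiSpaceTopology.
Variables (I : choiceType) (a : I -> set node).
Local Notation X := (psi_space a).

(** The second clause makes [inr i] the point at infinity of the sum of the fibres over [a i]. *)
Definition psi_open (U : set X) : Prop :=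
  (forall n, cantor_open [set t | U (inl (n, t))]) /\
  (forall i, U (inr i) -> finite_set [set n | a i n /\ exists t, ~ U (inl (n, t))]).

Lemma psi_openT : psi_open setT.
Proof.
split=> [n|i _]; first exact: cantor_openT.
by apply: (sub_finite_set _ (finite_set0 _)) => n [_ [t []]].
Qed.

Lemma psi_openI : setI_closed psi_open.
Proof.
move=> U V [U1 U2] [V1 V2]; split=> [n|i [/U2 fU /V2 fV]].
  exact: cantor_openI (U1 n) (V1 n).
have := conj fU fV; rewrite -finite_setU.
apply: sub_finite_set => n [an [t /not_andP[nU|nV]]].
  by left; split=> //; exists t.
by right; split=> //; exists t.
Qed.

Lemma psi_open_bigU (J : Type) (f : J -> set X) :
  (forall j, psi_open (f j)) -> psi_open (\bigcup_j f j).
Proof.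
move=> of_; split=> [n u [j _ fj]|i [j _ fj]].
  have [m mf] := proj1 (of_ j) n u fj; exists m => v /mf ?; by exists j.
apply: sub_finite_set (proj2 (of_ j) i fj) => n [an [t nt]]; split=> //.
by exists t => ft; apply: nt; exists j.
Qed.

HB.instance Definition _ :=
  @isOpenTopological.Build X psi_open psi_openT psi_openI psi_open_bigU.


Lemma psi_openE (U : set X) : open U = psi_open U.
Proof. by []. Qed.

Definition psi_continuous (f : X -> X) := forall U, psi_open U -> psi_open (f @^-1` U).

Lemma involution_homeomorphism (h : X -> X) (x : X) :
  (forall z, h (h z) = z) -> psi_continuous h ->
  exists f g : X -> X, homeomorphism f g /\ f x = h x.
Proof.
move=> hK ch; exists h, h; split=> //; split=> //.
  by apply/continuousP => U; rewrite !psi_openE; exact: ch.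
by apply/continuousP => U; rewrite !psi_openE; exact: ch.
Qed.

Definition cantor_xor (w u : cantor) : cantor := fun k => w k (+) u k.

Lemma cantor_xorK w : involutive (cantor_xor w).
Proof. by move=> u; apply/funext => k; rewrite /cantor_xor addKb. Qed.

Lemma cantor_xor_to u v : cantor_xor (cantor_xor u v) u = v.
Proof. by apply/funext => k; rewrite /cantor_xor addbC addKb. Qed.

Lemma pre_xor w u v m : pre u m = pre v m ->
  pre (cantor_xor w u) m = pre (cantor_xor w v) m.
Proof. by move=> /preP e; apply/preP => k /e; rewrite /cantor_xor => ->. Qed.

(** The same translation is used both ways, which gives an involution; for [n = m] it translates one
    fibre. *)
Definition swap_fibers (n m : node) (w : cantor) (x : X) : X :=
  match x with
  | inl (k, t) => if k == n then inl (m, cantor_xor w t)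
                  else if k == m then inl (n, cantor_xor w t) else inl (k, t)
  | inr i => inr i
  end.

Lemma swap_fibersK n m w x : swap_fibers n m w (swap_fibers n m w x) = x.
Proof.
case: x => [[k t]|i] //=.
case: (eqVneq k n) => [->|kn] /=.
  by case: (eqVneq m n) => [->|mn] /=; rewrite ?eqxx cantor_xorK.
case: (eqVneq k m) => [->|km] /=; first by rewrite eqxx cantor_xorK.
by rewrite (negbTE kn) (negbTE km).
Qed.

(** Only two fibres move, so the finite exceptional set at [inr i] gains at most [n] and [m]. *)
Lemma swap_fibers_continuous n m w : psi_continuous (swap_fibers n m w).
Proof.
move=> U [U1 U2].
have cw k : cantor_open [set t | U (inl (k, cantor_xor w t))].
  apply: (@cantor_open_preimage (cantor_xor w) [set t | U (inl (k, t))]); last exact: U1.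
  by move=> u p; exists p => v; exact: pre_xor.
split=> [k|i /U2 fU].
  rewrite /preimage /=; case: (k == n); first exact: cw.
  by case: (k == m); [exact: cw|exact: U1].
have := conj fU (finite_set2 n m); rewrite -finite_setU.
apply: sub_finite_set => k [ak [t]] /=.
case: (eqVneq k n) => [->|kn]; first by right; left.
case: (eqVneq k m) => [->|km]; first by right; right.
by move=> nU; left; split=> //; exists t.
Qed.

(* [0^k 1 v]: the words beginning with [0^k 1] are the copy of the [k]-th fiber over [a i]. *)
Definition zeros_one (k : nat) (v : cantor) : cantor :=
  fun j => if (j < k)%N then false else if j == k then true else v (j - k.+1)%N.

Section Enumerate.
Variables (i : I) (e : nat -> node).

(* A homeomorphism of [2^omega] onto the neighbourhood [{i} u (a i) x 2^omega] of [i]. *)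
Definition fan_map (u : cantor) : X :=
  match pselect (exists k, u k) with
  | left ex => inl (e (ex_minn ex), fun j => u (j + (ex_minn ex).+1)%N)
  | right _ => inr i
  end.

Lemma fan_map_zeros u : (forall k, u k = false) -> fan_map u = inr i.
Proof.
move=> u0; rewrite /fan_map; case: pselect => // ex; exfalso.
by case: ex => k; rewrite u0.
Qed.

Lemma fan_map_one u k : (forall j, (j < k)%N -> u j = false) -> u k ->
  fan_map u = inl (e k, fun j => u (j + k.+1)%N).
Proof.
move=> u0 uk; rewrite /fan_map; case: pselect => [ex|[]]; last by exists k.
case: ex_minnP => m um mmin; have -> // : m = k.
apply/eqP; rewrite eqn_leq mmin // leqNgt; apply/negP => /u0.
by rewrite um.
Qed.

Lemma fan_map_zeros_one k v : fan_map (zeros_one k v) = inl (e k, v).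
Proof.
rewrite (@fan_map_one _ k) => [|j jk|]; rewrite /zeros_one ?jk ?ltnn ?eqxx //.
congr (inl (_, _)); apply/funext => j; rewrite ltnNge -addSnnS leq_addl /=.
by rewrite gtn_eqF ?addSnnS ?leq_addl // addnK.
Qed.

Lemma zeros_oneP u k : (forall j, (j < k)%N -> u j = false) -> u k ->
  u = zeros_one k (fun j => u (j + k.+1)%N).
Proof.
move=> u0 uk; apply/funext => j; rewrite /zeros_one.
by case: ltngtP => [/u0 //|kj|->//]; rewrite subnK.
Qed.

Lemma fan_caseP u : (forall k, u k = false) \/ exists k v, u = zeros_one k v.
Proof.
have [ex|nex] := pselect (exists k, u k); last first.
  by left=> k; apply/negbTE/negP => uk; apply: nex; exists k.
right; case: (ex_minnP ex) => k uk kmin.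
exists k, (fun j => u (j + k.+1)%N); apply: zeros_oneP uk => j jk.
by apply/negbTE/negP => /kmin; rewrite leqNgt jk.
Qed.

Lemma pre_zeros_one u k v m : (m <= k)%N -> (forall j, u j = false) ->
  pre (zeros_one k v) m = pre u m.
Proof.
by move=> mk u0; apply/preP => j jm; rewrite /zeros_one (leq_trans jm mk) u0.
Qed.

Hypothesis e_inj : injective e.
Hypothesis e_range : range e = a i.

Lemma fan_map_continuous (U : set X) : psi_open U -> cantor_open (fan_map @^-1` U).
Proof.
move=> [U1 U2] u /=; case: (fan_caseP u) => [u0|[k [v ->]]].
  rewrite fan_map_zeros // => Ui; have fU := U2 i Ui.
  have : finite_set [set k | exists t, ~ U (inl (e k, t))].
    have : finite_set (e @` [set k | exists t, ~ U (inl (e k, t))]).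
      apply: sub_finite_set fU => _ [k [t nU] <-]; split; last by exists t.
      by rewrite -e_range; exists k.
    apply: contraPP => inf; move/infiniteP: inf => inf.
    by apply/infiniteP; apply: (card_le_trans inf); exact: card_le_inj_image.
  (* Zeros up to and including the last bad index keep [v] out of all fibres not contained in
     [U]. *)
  move=> /finite_seqP[s sE]; exists (\max_(j <- s) j).+1 => v /preP pv.
  case: (fan_caseP v) => [v0|[k [t vE]]].
    by rewrite fan_map_zeros.
  rewrite vE fan_map_zeros_one; apply: contrapT => nU.
  have ks : k \in s.
    by have : [set` s] k; [rewrite -sE; exists t|].
  have := pv k; rewrite ltnS (leq_bigmax_seq (F := id)) // vE /zeros_one ltnn eqxx u0.
  by move=> /(_ isT).
rewrite fan_map_zeros_one => Ukv; have [m mU] := U1 (e k) v Ukv.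
(* The first [k.+1] letters fix the fibre, the next [m] a cone in it. *)
exists (k.+1 + m)%N => w pw.
have wE : w = zeros_one k (fun j => w (j + k.+1)%N).
  apply: zeros_oneP => [j jk|]; move/preP: pw => ->; rewrite /zeros_one ?jk ?ltnn ?eqxx //.
    by apply: ltn_addr; exact: ltnW.
  by rewrite addSn ltnS leq_addr.
rewrite wE fan_map_zeros_one; apply: mU; apply/preP => j jm.
move/preP: pw => ->; last by rewrite addnC ltn_add2l.
rewrite /zeros_one ltnNge -addSnnS leq_addl /=.
by rewrite gtn_eqF ?addSnnS ?leq_addl // addnK.
Qed.

End Enumerate.
End PsiSpaceTopology.

Lemma enumerate_infinite (T : Type) (A : set T) : countable A -> infinite_set A ->
  exists2 e : nat -> T, injective e & range e = A.
Proof.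
move=> cA /infiniteP iA; have /card_bijP[f [g fK gK]] : ([set: nat] #= A)%card.
  by apply/card_eqPle.
exists (fun n => val (f (SigSub (mem_set (I : [set: nat] n))))).
  by move=> m n /val_inj/(can_inj fK)/(congr1 val).
apply/seteqP; split=> [_ [n _ <-]|x Ax]; first exact: set_valP.
exists (val (g (SigSub (mem_set Ax)))) => //.
rewrite -[RHS](_ : val (SigSub (mem_set Ax) : A) = x) //; congr val.
by rewrite -[RHS]gK; congr f; exact: val_inj.
Qed.

(** * Homogeneity and complete regularity of the space *)

Section PsiHomogeneous.
Variables (I : choiceType) (a : I -> set node).
Hypothesis a_infinite : forall i, infinite_set (a i).
Hypothesis a_disjoint : forall i j, i <> j -> finite_set (a i `&` a j).
Local Notation X := (psi_space a).

Section Flip.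
Variables (i : I) (e : nat -> node).
Hypothesis e_inj : injective e.
Hypothesis e_range : range e = a i.
Local Notation fan := (@fan_map I a i e).

(* Transports the translation by [w] of [2^omega] along [fan_map]. *)
Definition fan_flip (w : cantor) (x : X) : X :=
  match x with
  | inl (n, t) =>
    match pselect (exists k, e k = n) with
    | left ex => fan (cantor_xor w (zeros_one (projT1 (cid ex)) t))
    | right _ => inl (n, t)
    end
  | inr j => if j == i then fan w else inr j
  end.

Lemma fan_flip_fiber w k t :
  fan_flip w (inl (e k, t)) = fan (cantor_xor w (zeros_one k t)).
Proof.
rewrite /fan_flip; case: pselect => [ex|[]]; last by exists k.
by case: (cid ex) => l /= /e_inj ->.
Qed.

Lemma cantor_xor0 w u : (forall k, u k = false) -> cantor_xor w u = w.
Proof. by move=> u0; apply/funext => k; rewrite /cantor_xor u0 addbF. Qed.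

Lemma fan_flip_map w u : fan_flip w (fan u) = fan (cantor_xor w u).
Proof.
case: (fan_caseP u) => [u0|[k [v ->]]].
  by rewrite fan_map_zeros // cantor_xor0 //= eqxx.
by rewrite fan_map_zeros_one fan_flip_fiber.
Qed.

Lemma fan_flipK w x : fan_flip w (fan_flip w x) = x.
Proof.
have [[u <-]|nx] := pselect (exists u, fan u = x).
  by rewrite !fan_flip_map cantor_xorK.
suff fx : fan_flip w x = x by rewrite !fx.
case: x nx => [[n t]|j] nx /=.
  case: pselect => // -[k ek]; exfalso; apply: nx; exists (zeros_one k t).
  by rewrite fan_map_zeros_one ek.
case: eqP => // ji; exfalso; apply: nx; exists (fun=> false).
by rewrite fan_map_zeros // ji.
Qed.

(** Continuity at [inr i] is that of the fan map at [w]. At another [inr j], only the finitely many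
    fibres over both [a i] and [a j] are disturbed. *)
Lemma fan_flip_continuous w : psi_continuous (fan_flip w).
Proof.
move=> U oU; have [U1 U2] := oU; split=> [n|j].
  have [[k <-]|nn] := pselect (exists k, e k = n).
    have -> : [set t | (fan_flip w @^-1` U) (inl (e k, t))] =
        (fun t => cantor_xor w (zeros_one k t)) @^-1` (fan @^-1` U).
      by apply/funext => t; rewrite /preimage /mkset fan_flip_fiber.
    apply: cantor_open_preimage; last exact: fan_map_continuous.
    move=> u m; exists m => v /preP e'; apply: pre_xor; apply/preP => l lm.
    rewrite /zeros_one; case: ltngtP => // kl; apply: e'.
    exact: leq_ltn_trans (leq_subr _ _) lm.
  have -> : [set t | (fan_flip w @^-1` U) (inl (n, t))] = [set t | U (inl (n, t))].
    by apply/funext => t; rewrite /preimage /mkset /=; case: pselect.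
  exact: U1.
rewrite {1}/preimage /mkset /=; case: eqP => [->{j}|ji] Uj.
  have [m mU] := fan_map_continuous e_inj e_range oU Uj.
  apply: (@sub_finite_set _ _ (e @` `I_m)); last exact/finite_image/finite_II.
  rewrite -e_range => _ [[k _ <-] [t nUt]].
  have nU : ~ U (fan_flip w (inl (e k, t))) by [].
  rewrite fan_flip_fiber in nU.
  exists k => //=; rewrite ltnNge; apply/negP => mk; apply: nU; apply: mU.
  rewrite -[in RHS](@cantor_xor0 w (fun=> false)) //; apply: pre_xor.
  exact: pre_zeros_one.
have := conj (U2 j Uj) (a_disjoint ji); rewrite -finite_setU.
apply: sub_finite_set => n [an [t]]; rewrite /preimage /mkset /=.
case: pselect => [[k ek] _|_ nU]; last by left; split=> //; exists t.
by right; split=> //; rewrite -e_range; exists k.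
Qed.

End Flip.

Let moves (x y : X) := exists f g : X -> X, homeomorphism f g /\ f x = y.

Let moves_sym x y : moves x y -> moves y x.
Proof.
move=> [f [g [[fK gK cf cg] <-]]]; exists g, f; split; last exact: fK.
by split.
Qed.

Let moves_trans x y z : moves x y -> moves y z -> moves x z.
Proof.
move=> [f [g [[fK gK cf cg] <-]]] [f' [g' [[fK' gK' cf' cg'] <-]]].
exists (f' \o f), (g \o g'); split=> //; split.
- exact: can_comp.
- exact: can_comp.
- by move=> p; apply: continuous_comp; [exact: cf|exact: cf'].
- by move=> p; apply: continuous_comp; [exact: cg'|exact: cg].
Qed.

(** Swaps connect all fibre points; [inr i], the image of the zero sequence, is moved into a fibre
    by a translation of its fan. *)
Lemma psi_homogeneous : homogeneous X.
Proof.
have fib n m t s : moves (inl (n, t)) (inl (m, s)).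
  rewrite -(_ : swap_fibers n m (cantor_xor t s) (inl (n, t) : X) = inl (m, s)).
    apply: involution_homeomorphism; first exact: swap_fibersK.
    exact: swap_fibers_continuous.
  by rewrite /= eqxx cantor_xor_to.
have to_fib x : exists p, moves x (inl p).
  case: x => [p|i]; first by exists p; case: p => n t; exact: fib.
  have [e ei er] := enumerate_infinite (countableP _) (@a_infinite i).
  exists (e 0%N, fun=> false).
  rewrite -(fan_map_zeros_one a i e) -(@fan_map_zeros _ a i e (fun=> false)) //.
  set u := fun=> false; set v := zeros_one _ _.
  rewrite -(cantor_xor_to u v) -fan_flip_map //; apply: involution_homeomorphism.
    by move=> z; exact: fan_flipK.
  exact: fan_flip_continuous.
move=> x y; have [[n t] xp] := to_fib x; have [[m s] yq] := to_fib y.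
exact: moves_trans xp (moves_trans (fib _ _ _ _) (moves_sym yq)).
Qed.

Lemma psi_tychonoff : tychonoff_space X.
Proof.
have oF n W : cantor_open W -> open ([set x | exists2 t, W t & x = inl (n, t)] : set X).
  move=> oW; split=> [k t [t' Wt' [-> tE]]|i [t _] //].
  rewrite -tE in Wt'; have [m mW] := oW t Wt'.
  by exists m => v /mW ?; exists v.
have cone_o u m : cantor_open [set v | pre v m = pre u m].
  by move=> v pv; exists m => w pw; rewrite /mkset pw.
have oC n W : cantor_open (~` W) ->
    open (~` [set x : X | exists2 t, W t & x = inl (n, t)]).
  move=> oW; split=> [k t nt|i _].
    have [kn|kn] := pselect (k = n); last by exists 0%N => v _ [t' _ [/kn]].
    have [|m mW] := oW t; first by move=> Wt; apply: nt; exists t; rewrite ?kn.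
    by exists m => v /mW nWv [t' Wt' [_ vt]]; apply: nWv; rewrite vt.
  apply: (sub_finite_set _ (finite_set1 n)) => k [_ [t /contrapT[t' _ [-> _]]]].
  by [].
have oK i (U : set X) : open U -> U (inr i) -> exists N : set X,
    [/\ clopen N, N (inr i) & N `<=` U].
  move=> [U1 U2] Ui.
  (* [N] is [inr i] with the fibres over [a i] lying wholly in [U]; its complement is open at
     [inr j] by almost disjointness. *)
  pose G n := a i n /\ forall t, U (inl (n, t)).
  pose N : set X := [set x | match x with inl (n, _) => G n | inr j => j = i end].
  exists N; split=> //; last by case=> [[n t] [_ GU]|j ->] //; exact: GU.
  split.
    split=> [n t Gn|j ->]; first by exists 0%N.
    apply: sub_finite_set (U2 i Ui) => n [an [t nG]]; split=> //.
    apply: contrapT => nU; apply: nG; split=> // s; apply: contrapT => nUs.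
    by apply: nU; exists s.
  rewrite -openC; split=> [n t Gn|j ji]; first by exists 0%N.
  apply: sub_finite_set (a_disjoint ji) => n [an [t /contrapT[ain _]]].
  by split.
have clopen_base (x : X) (U : set X) : open U -> U x -> exists N : set X,
    [/\ clopen N, N x & N `<=` U].
  case: x => [[n t]|i] oU Ux; last exact: oK.
  have [m mU] := proj1 oU n t Ux.
  exists [set x | exists2 v, pre v m = pre t m & x = inl (n, v)]; split.
  - split; first by apply: oF; exact: cone_o.
    rewrite -openC; apply: oC => v nv; exists m => w pw pwt.
    by apply: nv; rewrite /mkset -pw.
  - by exists t.
  - by move=> _ [v /mU Uv ->].
split.
  move=> x y /eqP xy; exists (~` [set y]); split; last 2 first.
  - exact/mem_set.
  - by apply/mem_set => /(_ erefl).
  case: y xy => [[n t]|i] _.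
    have -> : ([set inl (n, t)] : set X) = [set x | exists2 v, v = t & x = inl (n, v)].
      by apply/seteqP; split=> [_ ->|_ [v -> ->]] //; exists t.
    apply: oC => v /first_difference[k [ne _]]; exists k.+1 => w /preP pw wt.
    by apply: ne; rewrite -wt pw.
  split=> [n t _|j ji]; first by exists 0%N.
  by apply: (sub_finite_set _ (finite_set0 _)) => n [_ [t]]; apply.
move=> x B cB nBx; have [|N [cN Nx NB]] := clopen_base x (~` B) _ nBx.
  exact: closed_openC.
exact: clopen_separator cN Nx NB.
Qed.

End PsiHomogeneous.

(** Replaces a countable-to-one map from [cantor] to [B], whose fibres are numbered by the second
    component, by an injective one. *)
Lemma has_continuum_fst (T : Type) (B : set T) (q : cantor -> T * nat) :
  injective q -> (forall u, B (q u).1) -> has_continuum B.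
Proof.
move=> qi qB; pose row (u : cantor) (n : nat) : cantor := fun k => u (pickle (n, k)).
(* Diagonalize over the countable power of the Cantor set: some index [n] takes all values. *)
have [n nP] : exists n, forall v, exists u, row u n = v /\ (q u).2 = n.
  apply: contrapT => H.
  have /choice[v vP] : forall n, exists v, forall u, row u n = v -> (q u).2 <> n.
    move=> n; apply: contrapT => H'; apply: H; exists n => v; apply: contrapT => nu.
    by apply: H'; exists v => u ru qu; apply: nu; exists u.
  pose u : cantor := fun m => if unpickle m is Some (n, k) then v n k else false.
  apply: (vP (q u).2 u) => //; apply/funext => k.
  by rewrite /row /u pickleK.
have /choice[r rP] := nP; exists (fun v => (q (r v)).1) => // v w e.
have [rv nv] := rP v; have [rw nw] := rP w.
rewrite -rv -rw; congr (row _ n); apply: qi.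
by move: e nv nw; case: (q _) => x k; case: (q _) => y l /= -> -> ->.
Qed.

(** * Weight, bounded sets and the dichotomy for open sets *)

Section PsiCompactness.
Variables (I : choiceType) (a : I -> set node).
Hypothesis a_mrowka : mrowka_family a.
Local Notation X := (psi_space a).

Let a_infinite := mf_infinite a_mrowka.
Let a_disjoint := mf_disjoint a_mrowka.
Let a_maximal := mf_maximal a_mrowka.

(** A base is coded by subsets of a countable set: the [inr] part lists cones, and the [inl] part
    singles out the one [i] whose [a i] equals it, if any. *)
Lemma psi_weight_le : weight_le X continuum.
Proof.
pose g (A : set (node + node * node)) : set X := [set x | match x with
  | inl (n, t) => exists2 s, A (inr (n, s)) & cone s t
  | inr i => a i = [set n | A (inl n)] end].
exists (range g `&` open); split; last first.
  have [e ei] := set_code (node + node * node)%type.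
  apply: (@card_le_trans _ _ _ (range g)).
    by apply: subset_card_le => b [].
  apply: (card_le_trans (card_image_le g _)).
  exact: (inj_le ei).
split=> [b []//|U x oU Ux]; have [U1 U2] := oU.
pose W (p : node * node) := forall t, cone p.2 t -> U (inl (p.1, t)).
have WU n t : (exists2 s, W (n, s) & cone s t) <-> U (inl (n, t)).
  split=> [[s Ws]|/U1[m mU]]; first exact: Ws.
  by exists (pre t m); [move=> v /cone_preP/mU|exact: cone_pre].
case: x Ux => [[n t] Ut|i Ui].
  pose A (p : node + node * node) := if p is inr q then W q else False.
  exists (g A); split=> [|/=|[[k s]|j] /=]; last 2 first.
  - by move/WU.
  - by move=> a0; exfalso; apply: (a_infinite (i := j)); rewrite a0; exact: finite_set0.
  - split; first by exists A.
    split=> [k s /= /WU /U1[m mU]|j /= a0]; first by exists m => v /mU /WU.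
    by exfalso; apply: (a_infinite (i := j)); rewrite a0; exact: finite_set0.
  - exact/WU.
pose A (p : node + node * node) :=
  match p with inr q => W q | inl n => a i n end.
exists (g A); split=> [|//|[[k s]|j] /=]; last 2 first.
- by move/WU.
- move=> ji; suff -> : j = i by [].
  apply: contrapT => /a_disjoint; rewrite ji setIid; exact: a_infinite.
split; first by exists A.
split=> [k s /= /WU /U1[m mU]|j /= ji]; first by exists m => v /mU /WU.
have {ji}-> : j = i.
  apply: contrapT => /a_disjoint; rewrite ji setIid; exact: a_infinite.
apply: sub_finite_set (U2 i Ui) => n [an [t nt]]; split=> //; exists t => Ut.
exact/nt/WU.
Qed.

(** The [V i] show that the points [inr i] form a discrete subspace, so basic neighbourhoods chosen
    inside them are distinct. *)
Lemma psi_base_ge (B : set (set X)) : is_base B -> (continuum #<= B)%card.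
Proof.
move=> [Bo Bb]; have [j ji _] := mf_continuum a_mrowka.
pose V i : set X := [set x | match x with inl _ => True | inr k => k = i end].
have oV i : open (V i).
  split=> [n t _|k ki]; first by exists 0%N.
  by apply: (sub_finite_set _ (finite_set0 _)) => n [_ [t []]].
have /choice[b bP] : forall u, exists b, [/\ B b, b (inr (j u)) & b `<=` V (j u)].
  by move=> u; exact: Bb (oV _) _.
apply: (@inj_le _ _ _ b) => [u v uv|u]; last by have [] := bP u.
have [_ bu _] := bP u; have [_ _ bv] := bP v.
by apply: ji; apply: (bv (inr (j u))); rewrite -uv.
Qed.

(** Combinatorial form of lying in a compact set: finitely many fans and fibres suffice as a
    cover. *)
Definition psi_bounded (P : set X) : Prop := exists (s : seq I) (D : seq node),
  forall x, P x -> match x with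
    | inl (n, _) => n \in D \/ exists2 i, i \in s & a i n
    | inr i => i \in s
    end.

Lemma psi_boundedS P Q : P `<=` Q -> psi_bounded Q -> psi_bounded P.
Proof. by move=> PQ [s [D H]]; exists s, D => x /PQ /H. Qed.

Definition cantor_dominated (P : set X) : Prop := exists2 phi : cantor -> X,
  (forall U, open U -> cantor_open (phi @^-1` U)) & P `<=` range phi.

(** $2^\omega$ splits into two copies of itself by the first bit. *)
Lemma cantor_dominatedU P Q :
  cantor_dominated P -> cantor_dominated Q -> cantor_dominated (P `|` Q).
Proof.
move=> [f cf Pf] [g cg Qg].
pose tl (u : cantor) : cantor := fun k => u k.+1.
pose hd b (u : cantor) : cantor := fun k => if k is l.+1 then u l else b.
exists (fun u => if u 0%N then f (tl u) else g (tl u)).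
  have ctl u v m : pre u m.+1 = pre v m.+1 -> pre (tl u) m = pre (tl v) m.
    by move=> /preP e; apply/preP => k km; exact: e.
  move=> U oU u; rewrite /preimage /mkset; case u0: (u 0%N) => Uu.
    have [m mU] := cf U oU _ Uu; exists m.+1 => v vu.
    have -> : v 0%N = true by rewrite -u0; move/preP: vu; exact.
    exact/mU/ctl.
  have [m mU] := cg U oU _ Uu; exists m.+1 => v vu.
  have -> : v 0%N = false by rewrite -u0; move/preP: vu; exact.
  exact/mU/ctl.
by move=> x [/Pf|/Qg] [u _ <-]; [exists (hd true u)|exists (hd false u)].
Qed.

Lemma cantor_dominated_fiber n : cantor_dominated [set x | exists t, x = inl (n, t)].
Proof.
exists (fun t => inl (n, t)); first by move=> U [U1 _]; exact: U1.
by move=> _ [t ->]; exists t.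
Qed.

Lemma cantor_dominated_fan i : cantor_dominated
  [set x | match x with inl (n, _) => a i n | inr j => j = i end].
Proof.
have [e ei er] := enumerate_infinite (countableP _) (@a_infinite i).
exists (@fan_map I a i e); first by move=> U oU; exact: fan_map_continuous.
case=> [[n t]|j].
  rewrite /mkset -er => -[k _ <-]; exists (zeros_one k t) => //.
  exact: fan_map_zeros_one.
move=> ->; exists (fun=> false) => //; exact: fan_map_zeros.
Qed.

Lemma bounded_cantor_dominated P : psi_bounded P -> cantor_dominated P.
Proof.
move=> [s [D H]].
pose K1 D' : set X := [set x | exists n t, n \in (D' : seq node) /\ x = inl (n, t)].
pose K2 s' : set X := [set x | exists2 i, i \in (s' : seq I) &
  match x with inl (n, _) => a i n | inr j => j = i end].
suff [phi cphi Pphi] : cantor_dominated (K1 D `|` K2 s).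
  exists phi => // x /H Px; apply: Pphi.
  case: x Px => [[n t] [nD|[i si ain]]|i si]; [left|right|right].
  - by exists n, t.
  - by exists i.
  - by exists i.
apply: cantor_dominatedU.
  elim: D {H} => [|n D IH].
    (* Even the empty set requires a total map; any fibre provides one. *)
    by have [phi cphi _] := cantor_dominated_fiber [::]; exists phi => // x [n [t []]].
  have [phi cphi Kphi] := cantor_dominatedU (cantor_dominated_fiber n) IH.
  exists phi => // x [m [t [/[1!inE] /orP[/eqP ->|mD] ->]]]; apply: Kphi.
    by left; exists t.
  by right; exists m, t.
elim: s {H} => [|i s IH].
  by have [phi cphi _] := cantor_dominated_fiber [::]; exists phi => // x [i].
have [phi cphi Kphi] := cantor_dominatedU (cantor_dominated_fan i) IH.
exists phi => // x [j /[1!inE] /orP[/eqP ->|sj]] xj; apply: Kphi.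
  by left.
by right; exists j.
Qed.

Let trace (P : set X) : set node := [set n | exists t, P (inl (n, t))].

Lemma closure_inr (P : set X) i :
  infinite_set (a i `&` trace P) -> closure P (inr i).
Proof.
move=> iP U; rewrite nbhsE => -[V [[V1 V2] Vi] VU].
have [n [[an [t Pt]] nbad]] :
    ((a i `&` trace P) `\` [set n | a i n /\ exists t, ~ V (inl (n, t))]) !=set0.
  by apply: infinite_setN0; apply: infinite_setD => //; exact: V2.
exists (inl (n, t)); split=> //; apply: VU; apply: contrapT => nV.
by apply: nbad; split=> //; exists t.
Qed.

Lemma open_inr_trace (P : set X) i : open P -> P (inr i) ->
  finite_set (a i `\` trace P).
Proof.
move=> [_ P2] Pi; apply: sub_finite_set (P2 i Pi) => n [an nt]; split=> //.
by exists (fun=> false) => Pn; apply: nt; exists (fun=> false).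
Qed.

(** Suppose [M] is countable. If it is finite, maximality leaves only finitely many nodes of the
    trace outside its members, so [P] is bounded. If it is infinite, a diagonal sequence [d] in the
    trace meets each of its members finitely often, contradicting maximality. *)
Lemma unbounded_trace (P : set X) : open P -> ~ psi_bounded P ->
  ~ countable [set i | infinite_set (a i `&` trace P)].
Proof.
move=> oP nP; set M := [set i | _] => cM.
have [/finite_seqP[s sM]|iM] := pselect (finite_set M).
  have /finite_seqP[D DE] :
      finite_set (trace P `\` [set n | exists2 i, i \in s & a i n]).
    apply: contrapT => /a_maximal[i iE].
    have Mi : M i by apply: sub_infinite_set iE => n [an [Pn _]].
    have [n [an [_ nx]]] := infinite_setN0 iE; apply: nx; exists i => //.
    by have : [set` s] i by rewrite -sM.
  apply: nP; exists s, D => -[[n t]|i] Px.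
    have [?|nx] := pselect (exists2 i, i \in s & a i n); first by right.
    left; have : [set` D] n by rewrite -DE; split=> //; exists t.
    by [].
  suff : [set` s] i by [].
  rewrite -sM; apply: infinite_almost_inside (@a_infinite i) _.
  exact: open_inr_trace.
have [e ei eM] := enumerate_infinite cM iM.
have /choice[d dP] : forall k, exists n,
    [/\ trace P n, a (e k) n & forall j, (j < k)%N -> ~ a (e j) n].
  move=> k; have : M (e k) by rewrite -eM; exists k.
  have fk : finite_set (\bigcup_(j in `I_k) (a (e k) `&` a (e j))).
    apply: bigcup_finite => // j /= jk; apply: a_disjoint => /ei kj.
    by rewrite kj ltnn in jk.
  move=> /(infinite_setD)/(_ fk)/infinite_setN0[n [[an Pn] nf]].
  by exists n; split=> // j jk ajn; apply: nf; exists j.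
have di : injective d.
  move=> k l kl; have [_ ak nk] := dP k; have [_ al nl] := dP l.
  case: (ltngtP k l) => // [/nl|/nk]; first by rewrite -kl.
  by rewrite kl.
have [i iE] := a_maximal (infinite_range di).
have : M i.
  apply: sub_infinite_set iE => n [an [k _ dk]]; split=> //.
  by rewrite -dk; have [] := dP k.
rewrite -eM => -[k _ eki]; apply: iE; rewrite -eki.
apply: (@sub_finite_set _ _ (d @` `I_k.+1)); last exact/finite_image/finite_II.
move=> n [akn [l _ dl]]; exists l => //=; rewrite ltnS leqNgt; apply/negP => kl.
by have [_ _ nl] := dP l; apply: (nl k kl); rewrite dl.
Qed.

(** For unbounded [P], uncountably many [inr i] are in its closure, hence in the open [P'], so that
    [a i] is almost inside the trace of [P']. If [Q] is unbounded too, [mf_merge] yields a common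
    limit point of [P'] and [Q']. *)
Lemma bounded_dichotomy (P P' Q Q' : set X) :
  open P -> open P' -> open Q -> open Q' ->
  closure P `<=` P' -> closure Q `<=` Q' -> closure P' `&` closure Q' `<=` set0 ->
  psi_bounded P \/ psi_bounded Q.
Proof.
move=> oP oP' oQ oQ' PP' QQ' disj; apply: contrapT => /not_orP[nP nQ].
have large R R' : open R -> open R' -> closure R `<=` R' -> ~ psi_bounded R ->
    ~ countable [set i | finite_set (a i `\` trace R')].
  move=> oR oR' RR' /(unbounded_trace oR); apply: contra_not; apply: sub_countable.
  apply: subset_card_le => i /closure_inr /RR'; exact: open_inr_trace.
have [i [/closure_inr Pi /closure_inr Qi]] :=
  mf_merge a_mrowka (large _ _ oP oP' PP' nP) (large _ _ oQ oQ' QQ' nQ).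
exact: disj _ (conj Pi Qi).
Qed.

End PsiCompactness.

(** * Continuous images of small weight *)

Lemma countable_base_onU (Y : topologicalType) (V W : set Y) :
  V `|` W = setT -> countable_base_on V -> countable_base_on W ->
  weight_le Y [set: nat].
Proof.
move=> VW [b ob bP] [c oc cP]; exists (range b `|` range c); split; last first.
  rewrite -bigcup2E; apply: bigcup_countable => // -[|[|k]] _ //=;
    by apply: (sub_countable (card_image_le _ _)); exact: countableP.
split=> [d [[k _ <-]|[k _ <-]] //|U y oU Uy].
have : (V `|` W) y by rewrite VW.
move=> [Vy|Wy].
  have [k [bk bkU]] := bP y U Vy oU Uy; exists (b k); split=> //; left; by exists k.
have [k [ck ckU]] := cP y U Wy oU Uy; exists (c k); split=> //; right; by exists k.
Qed.

Lemma countable_base_on_preimage (Y : topologicalType) (V : set Y) (f g : Y -> Y) :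
  homeomorphism f g -> countable_base_on V -> countable_base_on (f @^-1` V).
Proof.
move=> [fK gK cf cg] [b ob bP]; exists (fun k => f @^-1` b k).
  by move=> k; move/continuousP: cf; apply; exact: ob.
move=> y U Vy oU Uy.
have [||k [bk bkU]] := bP (f y) (g @^-1` U) Vy.
- by move/continuousP: cg; apply.
- by rewrite /= fK.
by exists k; split=> // z /bkU; rewrite /= fK.
Qed.

Section Images.
Variables (I : choiceType) (a : I -> set node).
Hypothesis a_mrowka : mrowka_family a.
Variables (Y : topologicalType) (f : psi_space a -> Y).
Hypothesis Y_tychonoff : tychonoff_space Y.
Hypothesis f_continuous : continuous f.
Hypothesis f_surjective : forall y, exists x, f x = y.

Let shrink (y : Y) (U : set Y) : open U -> U y ->
  exists V, [/\ open V, V y & closure V `<=` U].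
Proof. by case: Y_tychonoff => _ crY; exact: completely_regular_shrink. Qed.

Let open_f (U : set Y) : open U -> open (f @^-1` U).
Proof. by move: U; exact/continuousP. Qed.

Let closure_f (U V : set Y) : closure U `<=` V -> closure (f @^-1` U) `<=` f @^-1` V.
Proof.
move=> UV x clx; apply: UV => W /f_continuous /clx [z [Uz Wz]]; by exists (f z).
Qed.

Let hausdorffY : hausdorff_space Y.
Proof.
rewrite open_hausdorff => x y xy; have [T1 _] := Y_tychonoff.
have [U [oU /set_mem Ux /set_mem Uy]] := T1 _ _ xy.
have [V [oV Vx VU]] := shrink oU Ux.
exists (V, ~` closure V) => /=.
  by split; apply/mem_set => // /VU.
split=> //; first exact/closed_openC/closed_closure.
by apply/eqP; rewrite -subset0 => z [/subset_closure].
Qed.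

Lemma bounded_preimage_base (V : set Y) :
  open V -> psi_bounded (f @^-1` V) -> countable_base_on V.
Proof.
move=> oV /(bounded_cantor_dominated a_mrowka)[phi cphi Vphi].
apply: (@cantor_image_base _ V (f \o phi)) => //.
  move=> y Vy; have [x fx] := f_surjective y.
  have [|u _ ux] := Vphi x; first by rewrite /= fx.
  by exists u => //=; rewrite ux.
by move=> U /open_f /cphi.
Qed.

Let bounded_dichotomyY (P P' Q Q' : set Y) :
  open P -> open P' -> open Q -> open Q' ->
  closure P `<=` P' -> closure Q `<=` Q' -> closure P' `&` closure Q' `<=` set0 ->
  psi_bounded (f @^-1` P) \/ psi_bounded (f @^-1` Q).
Proof.
move=> oP oP' oQ oQ' PP' QQ' disj.
apply: (bounded_dichotomy a_mrowka (open_f oP) (open_f oP') (open_f oQ) (open_f oQ')).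
- exact: closure_f.
- exact: closure_f.
- move=> x [xP xQ]; apply: (disj (f x)); split.
    exact: (@closure_f P' (closure P')) xP.
  exact: (@closure_f Q' (closure Q')) xQ.
Qed.

Let bounded_point (y : Y) : Prop :=
  exists V, [/\ open V, V y & psi_bounded (f @^-1` V)].

(** Shrinking disjoint neighbourhoods twice makes the room for the dichotomy; thus at most one point
    is unbounded. *)
Lemma bounded_or_bounded (y z : Y) : y <> z -> bounded_point y \/ bounded_point z.
Proof.
move=> yz; have [A [B [oA oB Ay Bz AB]]] := hausdorff_separate hausdorffY yz.
have [A1 [oA1 A1y A1A]] := shrink oA Ay; have [A2 [oA2 A2y A2A]] := shrink oA1 A1y.
have [B1 [oB1 B1z B1B]] := shrink oB Bz; have [B2 [oB2 B2z B2B]] := shrink oB1 B1z.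
have [| |x|b|b] // := bounded_dichotomyY oA2 oA1 oB2 oB1.
- by move=> [/A1A Ax /B1B Bx]; exact: AB Ax Bx.
- by left; exists A2.
- by right; exists B2.
Qed.

(** A set with bounded preimage contains [f (inr i)] for finitely many [i] only. If all points were
    bounded, covering the images of continuum many [inr i] would take continuum many members of
    [B]. *)
Lemma unbounded_point_exists (B : set (set Y)) :
  is_base B -> ~ ([set: cantor] #<= B)%card -> exists y, ~ bounded_point y.
Proof.
move=> [Bo Bb] Bsmall; apply: contrapT => H; apply: Bsmall; apply: has_continuum_le.
have bdd y : bounded_point y by apply: contrapT => nb; apply: H; exists y.
have [j ji _] := mf_continuum a_mrowka.
have /choice[b bP] : forall u, exists b,
    [/\ B b, b (f (inr (j u))) & psi_bounded (f @^-1` b)].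
  move=> u; have [V [oV Vy fV]] := bdd (f (inr (j u))).
  have [b [Bb' by_ bV]] := Bb V _ oV Vy; exists b; split=> //.
  by apply: psi_boundedS fV => x /bV.
have /choice[s sP] : forall c : set Y, exists s : seq I, psi_bounded (f @^-1` c) ->
    forall i, c (f (inr i)) -> i \in s.
  move=> c; have [[s [D H']]|nb] := pselect (psi_bounded (f @^-1` c)).
    by exists s => _ i /(H' (inr i)).
  by exists [::] => /nb.
(* The list [s] depends only on the basic set, so this set and a position in the list recover
   [j u]. *)
apply: (@has_continuum_fst _ B (fun u => (b u, index (j u) (s (b u))))).
  move=> u v [buv iuv]; apply: ji.
  have [_ bu fu] := bP u; have [_ bv fv] := bP v.
  rewrite -(nth_index (j u) (sP _ fu _ bu)) -(nth_index (j u) (sP _ fv _ bv)).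
  by rewrite -iuv buv.
by move=> u; have [] := bP u.
Qed.

Lemma homogeneous_image_second_countable (B : set (set Y)) :
  is_base B -> ~ ([set: cantor] #<= B)%card -> homogeneous Y ->
  weight_le Y [set: nat].
Proof.
move=> baseB Bsmall homY; have [y0 ny0] := unbounded_point_exists baseB Bsmall.
have [V [oV Vy0 bV]] : exists V, [/\ open V, V y0 & countable_base_on V].
  (* Any other point is bounded, and homogeneity carries its second countable neighbourhood to [y0];
     a one-point [Y] is trivial. *)
  have [[y1 y10]|all] := pselect (exists y1, y1 <> y0).
    have [[V [oV Vy1 /(bounded_preimage_base oV) bV]]|//] := bounded_or_bounded y10.
    have [h [k [hk hy]]] := homY y0 y1; exists (h @^-1` V); split.
    - by have [_ _ /continuousP ch _] := hk; exact: ch.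
    - by rewrite /= hy.
    - exact: countable_base_on_preimage hk bV.
  exists setT; split=> //; first exact: openT.
  have eqy0 y : y = y0 by apply: contrapT => yy; apply: all; exists y.
  exists (fun=> setT); first by move=> k; exact: openT.
  by move=> y U _ _ Uy; exists 0%N; split=> // z _; rewrite (eqy0 z) -(eqy0 y).
(* The dichotomy compares the complement of [closure W4], with room up to that of [closure W3], and
   [W1], with room up to [W2]. The preimage of [W1] is unbounded because of [y0], and [V] contains
   [closure W4]. *)
have [W4 [oW4 W4y W4V]] := shrink oV Vy0; have [W3 [oW3 W3y W34]] := shrink oW4 W4y.
have [W2 [oW2 W2y W23]] := shrink oW3 W3y; have [W1 [oW1 W1y W12]] := shrink oW2 W2y.
have oC (W : set Y) : open (~` closure W) by exact/closed_openC/closed_closure.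
have clC (W : set Y) : open W -> closure (~` closure W) `<=` ~` W.
  move=> oW; rewrite [X in _ `<=` X](proj1 (closure_id _) (open_closedC oW)).
  by apply: closureS; apply: subsetC; exact: subset_closure.
have [| |x|bP|b1] := @bounded_dichotomyY _ (~` closure W3) _ _ (oC W4) (oC W3) oW1 oW2.
- by move=> x /(clC _ oW4) n4 /W34.
- exact: W12.
- by move=> [/(clC _ oW3) n3 /W23].
- apply: countable_base_onU (bounded_preimage_base (oC _) bP) bV.
  rewrite -subTset => x _; have [/W4V ?|?] := pselect (closure W4 x); by [right|left].
- by exfalso; apply: ny0; exists W1.
Qed.

End Images.

Theorem theorem3p1 :
  exists X : topologicalType,
    [/\ tychonoff_space X, homogeneous X,
        (* w(X) = c *)
        weight_le X continuum /\ ~ weight_lt X continuum &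
        forall (Y : topologicalType) (f : X -> Y),
          tychonoff_space Y -> continuous f -> (forall y : Y, exists x : X, f x = y) ->
          (* omega < w(Y) *) ~ weight_le Y [set: nat] ->
          (* w(Y) < c *) weight_lt Y continuum ->
          ~ homogeneous Y].
Proof.
have [I [a a_mrowka]] := mrowka_family_exists.
(* [{classic I}] gives the index type the choice structure that [psi_space] asks for. *)
pose a' : {classic I} -> set node := a.
have mf : mrowka_family a' by exact: a_mrowka.
exists (psi_space a'); split.
- exact: psi_tychonoff (mf_disjoint mf).
- exact: psi_homogeneous (mf_infinite mf) (mf_disjoint mf).
- split; first exact: psi_weight_le.
  by move=> [B [baseB _]]; apply; exact: psi_base_ge mf B baseB.
- move=> Y f tY cf sf nW [B [baseB _ Bsmall]] homY; apply: nW.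
  exact: (homogeneous_image_second_countable mf tY cf sf baseB Bsmall homY).
Qed.
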